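(* Let $R$ be a commutative Noetherian local ring. If $M$ and $N$ are finitely generated nonfree $R$-modules such that $\operatorname{pd}_R(M\otimes_R N)=1$, then $\operatorname{Tor}_1^R(M,N)\neq 0$.
   Context: $\operatorname{pd}_R$ denotes projective dimension. *)

(* Defs.v *)
From HB Require Import structures.
From mathcomp Require Import all_boot all_algebra.
From mathcomp Require Import boolp.
From mathcomp.multinomials Require Import freeg.

Set Implicit Arguments.
Unset Strict Implicit.
Unset Printing Implicit Defensive.

Import GRing.Theory.
Local Open Scope ring_scope.
Local Open Scope quotient_scope.

Section Rings.
Variable R : comNzRingType.

(* With the classical axioms of boolp, every subset is a boolean predicate, so
   [{pred R}] ranges over all subsets of R. *)
Definition ideal (I : {pred R}) : Prop := submod_closed (I : {pred R^o}).

Definition maximal_ideal (m : {pred R}) : Prop :=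
  [/\ ideal m, 1 \notin m &
      forall I : {pred R}, ideal I -> {subset m <= I} ->
        I =i m \/ I =i predT].

Definition local_ring : Prop :=
  exists2 m : {pred R}, maximal_ideal m &
    forall m' : {pred R}, maximal_ideal m' -> m' =i m.

Definition noetherian_ring : Prop :=
  forall I : {pred R}, ideal I ->
    exists (n : nat) (g : 'I_n -> R),
      forall x, x \in I <-> exists c : 'I_n -> R, x = \sum_i c i * g i.

End Rings.

Section Submodules.
Variables (R : comNzRingType) (V : lmodType R).

Section Sub.
Variable S : submodClosed V.

Record submod := Submod { submod_val : V; submod_valP : submod_val \in S }.

HB.instance Definition _ := [isSub for submod_val].
HB.instance Definition _ := [Choice of submod by <:].
HB.instance Definition _ := [SubChoice_isSubLmodule of submod by <:].

Definition sub_lmod : lmodType R := GRing.Lmodule.clone R submod _.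

End Sub.

Definition span_pred (S : V -> Prop) : {pred V} := fun x =>
  `[< forall U : {pred V}, submod_closed U -> (forall y, S y -> y \in U) ->
      x \in U >].

Lemma span_pred_closed (S : V -> Prop) : submod_closed (span_pred S).
Proof.
split=> [|a x y /asboolP hx /asboolP hy]; apply/asboolP => U hU SU.
  by case: hU.
by case: (hU) => _; apply; [apply: hx | apply: hy].
Qed.

HB.instance Definition _ (S : V -> Prop) :=
  GRing.isSubmodClosed.Build R V (span_pred S) (span_pred_closed S).

Lemma span_pred_gen (S : V -> Prop) x : S x -> x \in span_pred S.
Proof. by move=> Sx; apply/asboolP => U _; apply. Qed.

Lemma span_pred_min (S : V -> Prop) (U : {pred V}) :
  submod_closed U -> (forall y, S y -> y \in U) -> {subset span_pred S <= U}.
Proof. by move=> hU SU x /asboolP; apply. Qed.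

Section Quot.
Variable S : V -> Prop.

Definition quotmod := Quotient.quot (span_pred S).
HB.instance Definition _ := GRing.Zmodule.on quotmod.

Definition qpi (x : V) : quotmod := \pi_(Quotient.quot (span_pred S)) x.
Definition qrepr (x : quotmod) : V := repr (x : Quotient.quot (span_pred S)).

Lemma qreprK : cancel qrepr qpi.
Proof. exact: reprK. Qed.

Lemma qpi_eq x y : qpi x = qpi y <-> x - y \in span_pred S.
Proof.
rewrite Quotient.idealrBE; split; last by move/eqP.
by move=> h; apply/eqP.
Qed.

Lemma qpi_zmod : zmod_morphism qpi.
Proof. exact: (raddfB \pi_(Quotient.quot (span_pred S))). Qed.
HB.instance Definition _ := GRing.isZmodMorphism.Build V quotmod qpi qpi_zmod.

Definition qscale (a : R) (x : quotmod) : quotmod := qpi (a *: qrepr x).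

Lemma qscale_pi a x : qscale a (qpi x) = qpi (a *: x).
Proof.
by apply/qpi_eq; rewrite -scalerBr rpredZ //; apply/qpi_eq; rewrite qreprK.
Qed.

Lemma qscaleA a b v : qscale a (qscale b v) = qscale (a * b) v.
Proof. by rewrite -[v]qreprK !qscale_pi scalerA. Qed.

Lemma qscale1 : left_id 1 qscale.
Proof. by move=> v; rewrite -[v]qreprK qscale_pi scale1r. Qed.

Lemma qscaleDr : right_distributive qscale +%R.
Proof.
move=> a u v; rewrite -[u]qreprK -[v]qreprK -raddfD !qscale_pi.
by rewrite scalerDr raddfD.
Qed.

Lemma qscaleDl v : {morph qscale^~ v : a b / a + b}.
Proof. by move=> a b; rewrite -[v]qreprK !qscale_pi scalerDl raddfD. Qed.

HB.instance Definition _ :=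
  GRing.Zmodule_isLmodule.Build R quotmod qscaleA qscale1 qscaleDr qscaleDl.

Definition quot_lmod : lmodType R := GRing.Lmodule.clone R quotmod _.

Lemma qpi_scalable : scalable qpi.
Proof. by move=> a x; rewrite -qscale_pi. Qed.
HB.instance Definition _ :=
  GRing.isScalable.Build R V quotmod *:%R qpi qpi_scalable.

Section Lift.
Variables (W : lmodType R) (f : {linear V -> W}).
Hypothesis fS : forall x, S x -> f x = 0.

Lemma span_ker x : x \in span_pred S -> f x = 0.
Proof.
move=> xS; apply/eqP.
apply: (span_pred_min (S := S) (U := fun x => f x == 0)) xS => [|y Sy].
  split=> [|a u v /eqP fu /eqP fv]; rewrite unfold_in ?raddf0 //.
  by rewrite linearP fu fv scaler0 addr0.
by rewrite unfold_in fS.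
Qed.

End Lift.

End Quot.

Section QuotLift.
Variables (S : V -> Prop) (W : lmodType R) (f : {linear V -> W}).

Definition qlift (fS : forall x, S x -> f x = 0) (x : quotmod S) : W :=
  f (qrepr x).

Hypothesis fS : forall x, S x -> f x = 0.

Lemma qlift_pi x : qlift fS (qpi S x) = f x.
Proof.
apply/eqP; rewrite -subr_eq0 -raddfB; apply/eqP/(span_ker fS)/qpi_eq.
exact: qreprK.
Qed.

Lemma qlift_linear : linear (qlift fS).
Proof.
move=> a u v; rewrite -[u]qreprK -[v]qreprK -linearP !qlift_pi.
exact: linearP.
Qed.

End QuotLift.

HB.instance Definition _ (S : V -> Prop) (W : lmodType R)
    (f : {linear V -> W}) (fS : forall x, S x -> f x = 0) :=
  GRing.isLinear.Build R (quotmod S) W *:%R (qlift fS) (qlift_linear fS).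

End Submodules.

Section Modules.
Variable R : comNzRingType.

Definition ker_pred (V W : lmodType R) (f : {linear V -> W}) : {pred V} :=
  fun x => f x == 0.

Lemma ker_pred_closed (V W : lmodType R) (f : {linear V -> W}) :
  submod_closed (ker_pred f).
Proof.
split=> [|a u v /eqP fu /eqP fv]; rewrite unfold_in ?raddf0 //.
by rewrite linearP fu fv scaler0 addr0.
Qed.
HB.instance Definition _ (V W : lmodType R) (f : {linear V -> W}) :=
  GRing.isSubmodClosed.Build R V (ker_pred f) (ker_pred_closed f).

Definition kernel (V W : lmodType R) (f : {linear V -> W}) : submodClosed V :=
  GRing.SubmodClosed.clone R V (ker_pred f) _.

Definition fin_gen (M : lmodType R) : Prop :=
  exists (n : nat) (g : 'I_n -> M),
    forall x, exists c : 'I_n -> R, x = \sum_i c i *: g i.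

Definition free_mod (I : choiceType) : lmodType R :=
  GRing.Lmodule.clone R {freeg I / R} _.

Section FreeModule.
Variables (M : lmodType R) (I : choiceType) (e : I -> M).

Lemma fglift_linear : linear (fglift e : free_mod I -> M).
Proof.
have addf (x y : {freeg I / R}) : fglift e (x + y) = fglift e x + fglift e y.
  have B := @lift_is_additive R I M e.
  have f0 : fglift e 0 = 0 by rewrite -[X in fglift e X](subrr x) B subrr.
  by rewrite -[y in LHS]opprK B -[- y]add0r B f0 sub0r opprK.
have sumf (T : Type) (r : seq T) (F : T -> {freeg I / R}) :
    fglift e (\sum_(i <- r) F i) = \sum_(i <- r) fglift e (F i).
  elim: r => [|i r IH]; last by rewrite !big_cons addf IH.
  by rewrite !big_nil; apply: (addIr (fglift e 0)); rewrite -addf !add0r.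
move=> a x y; rewrite addf; congr (_ + _).
rewrite -[in RHS](freeg_sumE x) sumf scaler_sumr [a *: x]/(fgscale a x).
by rewrite /fgscale sumf; apply: eq_bigr => i _; rewrite !liftU scalerA.
Qed.

HB.instance Definition _ :=
  GRing.isLinear.Build R {freeg I / R} M *:%R (fglift e) fglift_linear.

End FreeModule.

(* [e] is a basis when the induced map from the finitely supported formal
   R-combinations of elements of [I] to [M] is bijective. *)
Definition free_module (M : lmodType R) : Prop :=
  exists (I : choiceType) (e : I -> M),
    bijective (fglift e : free_mod I -> M).

Definition projective (P : lmodType R) : Prop :=
  forall (A B : lmodType R) (g : {linear A -> B}) (f : {linear P -> B}),
    (forall b, exists a, g a = b) ->
    exists h : {linear P -> A}, forall x, g (h x) = f x.

Lemma freeg_projective (I : choiceType) : projective (free_mod I).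
Proof.
move=> A B g f g_surj.
pose e i := sval (cid (g_surj (f << i >>))).
have eP i : g (e i) = f << i >> by rewrite /e; case: cid.
exists (fglift e) => x; rewrite -(freeg_sumE x) !raddf_sum.
apply: eq_bigr => i _ /=; rewrite liftU linearZ eP -linearZ; congr (f _).
by apply/eqP/freeg_eqP => j; rewrite coeffZ !coeffU mul1r.
Qed.

Section Tensor.
Variables M N : lmodType R.

Inductive tensor_rel : free_mod (M * N)%type -> Prop :=
| tensor_addl m m' n :
    tensor_rel (<< (m + m', n) >> - << (m, n) >> - << (m', n) >>)
| tensor_addr m n n' :
    tensor_rel (<< (m, n + n') >> - << (m, n) >> - << (m, n') >>)
| tensor_scalel a m n : tensor_rel (<< (a *: m, n) >> - a *: << (m, n) >>)
| tensor_scaler a m n : tensor_rel (<< (m, a *: n) >> - a *: << (m, n) >>).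

Definition tensor : lmodType R := quot_lmod tensor_rel.

Definition tens (m : M) (n : N) : tensor := qpi tensor_rel << (m, n) >>.

Let rel0 x y : tensor_rel (x - y) -> qpi tensor_rel x = qpi tensor_rel y.
Proof. by move=> h; apply/qpi_eq/span_pred_gen. Qed.

Lemma tensDl m m' n : tens (m + m') n = tens m n + tens m' n.
Proof.
by rewrite /tens -raddfD; apply: rel0; rewrite opprD addrA; exact: tensor_addl.
Qed.

Lemma tensDr m n n' : tens m (n + n') = tens m n + tens m n'.
Proof.
by rewrite /tens -raddfD; apply: rel0; rewrite opprD addrA; exact: tensor_addr.
Qed.

Lemma tensZl a m n : tens (a *: m) n = a *: tens m n.
Proof. by rewrite /tens -linearZ; apply: rel0; exact: tensor_scalel. Qed.

Lemma tensZr a m n : tens m (a *: n) = a *: tens m n.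
Proof. by rewrite /tens -linearZ; apply: rel0; exact: tensor_scaler. Qed.

Lemma tens_ext (W : lmodType R) (f g : {linear tensor -> W}) :
  (forall m n, f (tens m n) = g (tens m n)) -> f =1 g.
Proof.
move=> fg x; rewrite -[x]qreprK -(freeg_sumE (qrepr x)) !raddf_sum.
apply: eq_bigr => -[m n] _ /=; set c := coeff _ _.
have -> : << c *g (m, n) >> = c *: << (m, n) >> :> free_mod (M * N)%type.
  by apply/eqP/freeg_eqP => j; rewrite coeffZ !coeffU mul1r.
by rewrite 3!linearZ /= fg.
Qed.

End Tensor.

Section TensorLift.
Variables (M N W : lmodType R) (b : M -> N -> W).
Hypotheses (b_l : forall n, linear (b^~ n)) (b_r : forall m, linear (b m)).

Definition tens_lift_free : {linear free_mod (M * N)%type -> W} :=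
  fglift (fun p : M * N => b p.1 p.2).

Lemma tens_lift_rel x : tensor_rel x -> tens_lift_free x = 0.
Proof.
have freeE m n : tens_lift_free << (m, n) >> = b m n.
  by rewrite /= liftU scale1r.
have b0l n : b 0 n = 0.
  by have := b_l n 1 0 0; rewrite !scale1r addr0 => /esym/(canRL (addrK _));
     rewrite subrr.
have b0r m : b m 0 = 0.
  by have := b_r m 1 0 0; rewrite !scale1r addr0 => /esym/(canRL (addrK _));
     rewrite subrr.
case=> [m m' n|m n n'|a m n|a m n];
  rewrite !linearB ?[tens_lift_free (_ *: _)]linearZZ !freeE.
- by have := b_l n 1 m m'; rewrite !scale1r => ->; rewrite addrAC addrK subrr.
- by have := b_r m 1 n n'; rewrite !scale1r => ->; rewrite addrAC addrK subrr.
- by have := b_l n a m 0; rewrite !addr0 b0l addr0 => ->; rewrite subrr.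
- by have := b_r m a n 0; rewrite !addr0 b0r addr0 => ->; rewrite subrr.
Qed.

Definition tens_lift : {linear tensor M N -> W} := qlift tens_lift_rel.

Lemma tens_liftE m n : tens_lift (tens m n) = b m n.
Proof.
apply: etrans (qlift_pi tens_lift_rel _) _.
by rewrite /= liftU scale1r.
Qed.

End TensorLift.

Section TensorMap.
Variables (M M' N : lmodType R) (f : {linear M -> M'}).

Lemma tens_map_l (n : N) : linear (fun m => tens (f m) n).
Proof. by move=> a m m'; rewrite linearP tensDl tensZl. Qed.

Lemma tens_map_r (m : M) : linear (fun n : N => tens (f m) n).
Proof. by move=> a n n'; rewrite tensDr tensZr. Qed.

Definition tens_map : {linear tensor M N -> tensor M' N} :=
  tens_lift tens_map_l tens_map_r.

Lemma tens_mapE m n : tens_map (tens m n) = tens (f m) n.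
Proof. exact: tens_liftE. Qed.

End TensorMap.

Record complex := Complex {
  cx_obj :> nat -> lmodType R;
  cx_d : forall n, {linear cx_obj n.+1 -> cx_obj n};
  cx_dd : forall n x, cx_d n (cx_d n.+1 x) = 0
}.

Section Homology.
Variable C : complex.

Definition cycle_pred (n : nat) : {pred C n} :=
  match n return {pred C n} with
  | 0 => predT
  | k.+1 => ker_pred (cx_d C k)
  end.

Lemma cycle_pred_closed n : submod_closed (@cycle_pred n).
Proof. by case: n => [|n]; [split | apply: ker_pred_closed]. Qed.
HB.instance Definition _ n :=
  GRing.isSubmodClosed.Build R (C n) (@cycle_pred n) (@cycle_pred_closed n).

Definition cycles n : submodClosed (C n) :=
  GRing.SubmodClosed.clone R (C n) (@cycle_pred n) _.

Definition boundary n (z : sub_lmod (cycles n)) : Prop :=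
  exists y : C n.+1, cx_d C n y = submod_val z.

Definition homology n : lmodType R := quot_lmod (@boundary n).

End Homology.

Record proj_resolution (M : lmodType R) := ProjResolution {
  res_cx :> complex;
  res_aug : {linear res_cx 0%N -> M};
  res_proj : forall n, projective (res_cx n);
  res_surj : forall m, exists x, res_aug x = m;
  res_augd : forall y, res_aug (cx_d res_cx 0 y) = 0;
  res_exact0 : forall x, res_aug x = 0 -> exists y, cx_d res_cx 0 y = x;
  res_exact : forall n x, cx_d res_cx n x = 0 ->
    exists y, cx_d res_cx n.+1 y = x
}.

Definition projdim_le (M : lmodType R) (n : nat) : Prop :=
  exists P : proj_resolution M, forall i, (n < i)%N -> forall x : P i, x = 0.

(* [None] stands for infinite projective dimension; with this definition the
   zero module gets [Some 0]. *)
Definition projdim (M : lmodType R) : option nat :=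
  if pselect (exists n, `[< projdim_le M n >]) is left h
  then Some (ex_minn h) else None.

(* The standard free resolution of M: K_0 = M, P_n is free on the set K_n, and
   K_(n+1) is the kernel of the canonical surjection P_n -> K_n. *)
Section StdResolution.
Variable M : lmodType R.

Definition cover (K : lmodType R) : {linear free_mod K -> K} :=
  fglift (fun x : K => x).

Lemma cover_surj (K : lmodType R) (x : K) : exists y, cover K y = x.
Proof. by exists (<< x >> : free_mod K); rewrite /= liftU scale1r. Qed.

Fixpoint syzygy (n : nat) : lmodType R :=
  if n is k.+1 then sub_lmod (kernel (cover (syzygy k))) else M.

Definition std_obj n : lmodType R := free_mod (syzygy n).

Definition std_d n (x : std_obj n.+1) : std_obj n :=
  submod_val (cover (syzygy n.+1) x).

Lemma std_d_linear n : linear (@std_d n).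
Proof. by move=> a x y; rewrite /std_d linearP. Qed.
HB.instance Definition _ n :=
  GRing.isLinear.Build R (std_obj n.+1) (std_obj n) *:%R (@std_d n)
    (@std_d_linear n).

Lemma std_cover_d n x : cover (syzygy n) (std_d x) = 0.
Proof. exact/eqP/(submod_valP (cover (syzygy n.+1) x)). Qed.

Lemma std_dd n (x : std_obj n.+2) : std_d (std_d x) = 0.
Proof. by rewrite {1}/std_d std_cover_d. Qed.

Lemma std_exact_cover n x : cover (syzygy n) x = 0 -> exists y, std_d y = x.
Proof.
move=> /eqP x0; have [y yE] := @cover_surj (syzygy n.+1)
  (Submod (S := kernel (cover (syzygy n))) x0).
by exists y; rewrite /std_d yE.
Qed.

Lemma std_exact n (x : std_obj n.+1) :
  std_d x = 0 -> exists y, @std_d n.+1 y = x.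
Proof. by move=> x0; apply: std_exact_cover; apply: val_inj. Qed.

Definition std_complex : complex :=
  @Complex std_obj (fun n => @std_d n) std_dd.

Definition std_resolution : proj_resolution M :=
  @ProjResolution M std_complex (cover M)
    (fun n => @freeg_projective (syzygy n)) (@cover_surj M)
    (@std_cover_d 0) (@std_exact_cover 0) std_exact.

End StdResolution.

Section Tor.
Variables M N : lmodType R.

Lemma tensor_dd (C : complex) n x :
  tens_map N (cx_d C n) (tens_map N (cx_d C n.+1) x) = 0.
Proof.
pose h : {linear tensor (C n.+2) N -> tensor (C n) N} :=
  tens_map N (cx_d C n) \o tens_map N (cx_d C n.+1).
pose z : {linear tensor (C n.+2) N -> tensor (C n) N} := \0.
apply: (tens_ext (f := h) (g := z)) => m k.
change (tens_map N (cx_d C n) (tens_map N (cx_d C n.+1) (tens m k)) = 0).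
rewrite !tens_mapE cx_dd.
by have := tensZl 0 (0 : C n) k; rewrite !scale0r.
Qed.

Definition tensor_complex (C : complex) : complex :=
  @Complex (fun n => tensor (C n) N) (fun n => tens_map N (cx_d C n))
    (@tensor_dd C).

Definition Tor (n : nat) : lmodType R :=
  homology (tensor_complex (std_resolution M)) n.

End Tor.

End Modules.

(* Main.v *)
From HB Require Import structures.
Require Import Defs.
From mathcomp Require Import all_boot all_algebra.
From mathcomp Require Import boolp classical_sets.
From mathcomp.multinomials Require Import freeg.

Set Implicit Arguments.
Unset Strict Implicit.
Unset Printing Implicit Defensive.

Import GRing.Theory.

(** Choose minimal generators g_1, .., g_a of M and h_1, .., h_b of N.  The
    tensor product of the free modules on them is the module of a x b matrices,
    and the matrix A is sent to the sum of the A_ij (g_i tensor h_j).  By right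
    exactness, the kernel of this map onto the tensor product of M and N is
    K = X + Y, where X consists of the matrices whose columns are relations
    between the g_i and Y of those whose rows are relations between the h_j
    ([tensor_comb_kernel]).

    By Schanuel's lemma the projective dimension hypothesis makes K projective
    ([kernel_projective]).  If Tor_1(M, N) vanishes, then the intersection of X
    and Y is spanned by the products c d, with c a column of relations and d a
    row of relations ([Tor1_zero_outer]).  The generators being minimal, the
    entries of c and d lie in the maximal ideal m, so this intersection lies
    both in mX and in mY.  Splitting the surjection from X + Y, as an external
    sum, onto the projective K then shows that the intersection W equals mW,
    hence is zero by Nakayama ([projective_sum_direct]).

    So c d = 0 for all relations c and d.  N is not free, so some relation d has
    an entry t <> 0; then t annihilates X.  But X is now a direct summand of the
    projective module K, and a projective module annihilated by t <> 0 is equal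
    to m times itself, its coordinates being annihilated by t and thus not
    invertible ([projective_sum_annihilated]).  Hence X = 0, the g_i have no
    relation, and M is free. *)

(** * Noetherian and local rings *)

Section LocalRing.
Local Open Scope ring_scope.
Variable R : comNzRingType.

Section Closed.
Variables (V : lmodType R) (U : {pred V}) (Ucl : submod_closed U).

Lemma submod_closed_add x y : x \in U -> y \in U -> x + y \in U.
Proof. by move=> Ux Uy; have [_ UP] := Ucl; rewrite -[x]scale1r UP. Qed.

Lemma submod_closed_scale a x : x \in U -> a *: x \in U.
Proof. by move=> Ux; have [U0 UP] := Ucl; rewrite -[_ *: _]addr0 UP. Qed.

Lemma submod_closed_sub x y : x \in U -> y \in U -> x - y \in U.
Proof.
by move=> Ux Uy; rewrite -scaleN1r submod_closed_add // submod_closed_scale.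
Qed.

Lemma submod_closed_sum n (F : 'I_n -> V) :
  (forall i, F i \in U) -> \sum_i F i \in U.
Proof.
move=> UF; elim/big_ind: _ => //; first by case: Ucl.
exact: submod_closed_add.
Qed.

End Closed.

Lemma submodClosed_sub (V : lmodType R) (S : submodClosed V) x y :
  x \in S -> y \in S -> x - y \in S.
Proof. by move=> Sx Sy; rewrite -scaleN1r rpredD ?rpredZ. Qed.

Definition spans (V : lmodType R) (W : {pred V}) n (g : 'I_n -> V) : Prop :=
  forall x, x \in W -> exists c : 'I_n -> R, x = \sum_i c i *: g i.

Definition generates (V : lmodType R) (W : {pred V}) n (g : 'I_n -> V) : Prop :=
  (forall i, g i \in W) /\ spans W g.

Definition finite_submod (V : lmodType R) (W : {pred V}) : Prop :=
  exists n (g : 'I_n -> V), generates W g.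

(** Induction on the number of generators of the ambient module: the
    coefficients on the first one form an ideal, and subtracting lifts of its
    generators leaves an element of the span of the others. *)
Lemma noetherian_submod (V : lmodType R) (W : {pred V}) n (g : 'I_n -> V) :
  noetherian_ring R -> submod_closed W -> spans W g -> finite_submod W.
Proof.
move=> noeth; elim: n W g => [|n IH] W g Wcl Wg.
  by exists 0%N, g; split=> [[]|].
pose I : {pred R} := fun r => `[< exists c : 'I_n -> R,
  r *: g ord0 + \sum_i c i *: g (fintype.lift ord0 i) \in W >].
have Icl : ideal I.
  split=> [|a u v /asboolP [c cW] /asboolP [d dW]]; apply/asboolP.
    exists (fun=> 0); rewrite scale0r add0r big1 => [|i _]; last exact: scale0r.
    by case: Wcl.
  exists (fun i => a * c i + d i).
  have [_ /(_ a _ _ cW dW)] := Wcl; congr (_ \in W).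
  rewrite scalerDr scalerA scaler_sumr addrACA -scalerDl -big_split /=.
  by congr (_ + _); apply: eq_bigr => i _; rewrite scalerA -scalerDl.
have [k [r rI]] := noeth I Icl.
have w_ex l : exists c : 'I_n -> R,
    r l *: g ord0 + \sum_i c i *: g (fintype.lift ord0 i) \in W.
  apply/asboolP; rewrite -[`[< _ >]]/(r l \in I).
  apply/rI; exists (fun i => (i == l)%:R).
  rewrite (bigD1 l) //= eqxx mul1r big1 ?addr0 // => i /negbTE ->.
  exact: mul0r.
have [c cW] := choice w_ex.
pose w l := r l *: g ord0 + \sum_i c l i *: g (fintype.lift ord0 i).
pose W' : {pred V} := fun x => (x \in W) && `[< exists d : 'I_n -> R,
  x = \sum_i d i *: g (fintype.lift ord0 i) >].
have W'cl : submod_closed W'.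
  split=> [|a u v /andP [uW /asboolP [d uE]] /andP [vW /asboolP [e vE]]].
    apply/andP; split; first by case: Wcl.
    apply/asboolP; exists (fun=> 0).
    by rewrite big1 // => i _; exact: scale0r.
  apply/andP; split; first by have [_ WP] := Wcl; apply: WP.
  apply/asboolP; exists (fun i => a * d i + e i).
  rewrite uE vE scaler_sumr -big_split /=; apply: eq_bigr => i _.
  by rewrite scalerA -scalerDl.
have [|k' [h [hW' hspan]]] := IH W' (fun i => g (fintype.lift ord0 i)) W'cl.
  by move=> x /andP [_ /asboolP [d ->]]; exists d.
exists (k + k')%N,
  (fun i => match split i with inl l => w l | inr j => h j end).
split=> [i|x xW].
  by case: split => [l|j]; [exact: cW | case/andP: (hW' j)].
have [e xE] := Wg x xW; rewrite big_ord_recl in xE.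
have : e ord0 \in I.
  by apply/asboolP; exists (fun i => e (fintype.lift ord0 i)); rewrite -xE.
case/rI => f fE.
have : x - \sum_l f l *: w l \in W'.
  apply/andP; split.
    apply: submod_closed_sub => //; apply: submod_closed_sum => // l.
    exact: submod_closed_scale (cW l).
  apply/asboolP; exists (fun i => e (fintype.lift ord0 i) - \sum_l f l * c l i).
  rewrite xE fE scaler_suml.
  under [\sum_l f l *: w l]eq_bigr do rewrite scalerDr scalerA.
  rewrite big_split /= opprD addrACA subrr add0r.
  under [RHS]eq_bigr do rewrite scalerBl scaler_suml.
  rewrite sumrB; congr (_ - _); rewrite exchange_big; apply: eq_bigr => l _.
  by rewrite scaler_sumr; apply: eq_bigr => i _; rewrite scalerA.
case/hspan => d dE.
exists (fun i => match split i with inl l => f l | inr j => d j end).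
rewrite big_split_ord /= -[LHS](subrK (\sum_l f l *: w l)) dE [RHS]addrC.
congr (_ + _); apply: eq_bigr => i _.
  by have -> : split (rshift k i) = inr i := unsplitK (inr i).
by have -> : split (lshift k' i) = inl i := unsplitK (inl i).
Qed.

(** Zorn's lemma gives a maximal ideal above the ideal of multiples of a
    non-invertible element. *)
Lemma local_ring_units : local_ring R -> exists m : {pred R},
  [/\ ideal m, 1 \notin m & forall x, x \notin m -> exists y, y * x = 1].
Proof.
case=> m [mcl m1 _] m_uniq; exists m; split=> // x xm.
apply: contrapT => x_inv; case/negP: xm.
pose up (A : set R) : {pred R} := fun z => `[< A z \/ exists r, z = r * x >].
(* The multiples of x are added to A so that the empty chain has an upper
   bound. *)
pose P (A : set R) := ideal (up A) /\ 1 \notin up A.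
have xup A : x \in up A by apply/asboolP; right; exists 1; rewrite mul1r.
have Aup (A : set R) z : A z -> z \in up A by move=> Az; apply/asboolP; left.
have mulup A r : r * x \in up A by apply/asboolP; right; exists r.
have [F FP Ftot|A [[Acl A1] Amax]] := @Zorn_bigcup R P.
  have upF X z : F X -> z \in up X -> z \in up (\bigcup_(Y in F) Y)%classic.
    move=> FX /asboolP [Xz|[r ->]]; last exact: mulup.
    by apply: Aup; exists X.
  have upP z : z \in up (\bigcup_(Y in F) Y)%classic ->
      (exists r, z = r * x) \/ exists2 X, F X & X z.
    by case/asboolP => [[X FX Xz]|zx]; [right; exists X | left].
  split; last first.
    apply/negP => /upP [[r r1]|[X FX X1]]; first by apply: x_inv; exists r.
    by have [_ /negP] := FP X FX; apply; apply: Aup.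
  split=> [|a u v]; first by rewrite -[0](mul0r x).
  have one X : F X -> u \in up X -> v \in up X ->
      a *: (u : R^o) + v \in up (\bigcup_(Y in F) Y)%classic.
    move=> FX uX vX; apply: (upF X) => //.
    by have [[_ Xcl] _] := FP X FX; apply: Xcl.
  move=> /upP [[r ur]|[X FX Xu]] /upP [[s vs]|[Y FY Yv]].
  - by rewrite -[_ *: _]/(a * u) ur vs mulrA -mulrDl.
  - by apply: (one Y); rewrite ?ur //; apply: Aup.
  - by apply: (one X); rewrite ?vs //; apply: Aup.
  - case: (Ftot X Y FX FY) => sub.
      by apply: (one Y) => //; apply: Aup => //; exact: sub.
    by apply: (one X) => //; apply: Aup => //; exact: sub.
suff /m_uniq <- : maximal_ideal (up A) by [].
split=> // J Jcl AJ; have [J1|J1] := boolP (1 \in J).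
  right=> z; rewrite !inE -[z]mulr1.
  exact: (submod_closed_scale (V := R^o) Jcl z J1).
left=> z; apply/idP/idP => [zJ|]; last exact: AJ.
apply: contrapT => zA.
have upJ : up [set t | t \in J]%classic =i J.
  move=> t; apply/idP/idP => [/asboolP [//|[r ->]]|tJ]; last exact: Aup.
  exact/AJ/mulup.
apply: (Amax [set t | t \in J]%classic).
  split=> [t At|JA]; first by apply/AJ/Aup.
  by apply/zA/Aup/JA.
split; last by rewrite upJ.
have [J0 JP] := Jcl.
by split=> [|a u v]; rewrite !upJ //; apply: JP.
Qed.

Variable m : {pred R}.
Hypotheses (mcl : ideal m) (m1 : 1 \notin m).
Hypothesis m_unit : forall x, x \notin m -> exists y, y * x = 1.

(** Taking as few generators as possible: a relation with an invertible
    coefficient would let one generator be dropped. *)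
Lemma minimal_generators (V : lmodType R) (W : {pred V}) :
  finite_submod W -> exists n (g : 'I_n -> V), generates W g /\
    forall c : 'I_n -> R, \sum_i c i *: g i = 0 -> forall i, c i \in m.
Proof.
move=> Wfin.
have ex_n : exists n, `[< exists g : 'I_n -> V, generates W g >].
  by have [n gn] := Wfin; exists n; apply/asboolP.
case: (ex_minnP ex_n) => n /asboolP [g [gW Wg]] nmin.
exists n, g; split=> // c c0 i; apply/negPn/negP => /m_unit [y y1].
case: n i g gW Wg nmin c c0 y1 => [[]//|n] i g gW Wg nmin c c0 y1.
suff /nmin : `[< exists h : 'I_n -> V, generates W h >] by rewrite ltnn.
have drop d : \sum_j d j *: g j = d i *: g i +
    \sum_j d (fintype.lift i j) *: g (fintype.lift i j).
  by rewrite (bigD1_ord i).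
apply/asboolP; exists (fun j => g (fintype.lift i j)); split=> // x /Wg [d ->].
have gi : g i = - \sum_j (y * c (fintype.lift i j)) *: g (fintype.lift i j).
  apply/eqP; rewrite -addr_eq0 -[X in X + _]scale1r -y1 -scalerA.
  under eq_bigr do rewrite -scalerA.
  by rewrite -scaler_sumr -scalerDr -drop c0 scaler0.
exists (fun j => d (fintype.lift i j) - d i * (y * c (fintype.lift i j))).
rewrite drop gi scalerN scaler_sumr addrC -sumrB; apply: eq_bigr => j _.
by rewrite scalerA scalerBl.
Qed.

Definition max_mul (V : lmodType R) (W : {pred V}) : V -> Prop :=
  fun x => exists a w, [/\ a \in m, w \in W & x = a *: w].

(** Nakayama's lemma: in a minimal family of generators, expressing the first
    one with coefficients in the maximal ideal gives a relation in which it has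
    an invertible coefficient. *)
Lemma nakayama (V : lmodType R) (W : {pred V}) :
  finite_submod W -> {subset W <= span_pred (max_mul W)} ->
  forall x, x \in W -> x = 0.
Proof.
move=> /minimal_generators [[|n] [g [[gW Wg] g_min]]] WmW x xW.
  by have [c ->] := Wg x xW; rewrite big_ord0.
pose U : {pred V} := fun z => `[< exists2 c : 'I_n.+1 -> R,
  forall i, c i \in m & z = \sum_i c i *: g i >].
have Ucl : submod_closed U.
  split=> [|a u v /asboolP [c cm ->] /asboolP [d dm ->]]; apply/asboolP.
    exists (fun=> 0) => [i|]; first by case: mcl.
    by rewrite big1 // => i _; exact: scale0r.
  exists (fun i => a * c i + d i) => [i|].
    by have [_ mP] := mcl; apply: mP.
  rewrite scaler_sumr -big_split /=; apply: eq_bigr => i _.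
  by rewrite scalerA -scalerDl.
have /asboolP [c cm g0E] : g ord0 \in U.
  apply: (span_pred_min Ucl) (WmW _ (gW ord0)) => _ [a [w [am /Wg [d ->] ->]]].
  apply/asboolP; exists (fun i => a * d i) => [i|].
    by rewrite mulrC; apply: (submod_closed_scale (V := R^o) mcl).
  by rewrite scaler_sumr; apply: eq_bigr => i _; rewrite scalerA.
case/negP: m1; rewrite -(subrK (c ord0) 1).
apply: (submod_closed_add (V := R^o) mcl) => //.
have := g_min (fun i => (i == ord0)%:R - c i) _ ord0; rewrite eqxx; apply.
under eq_bigr do rewrite scalerBl.
rewrite sumrB -g0E (bigD1 ord0) //= scale1r big1 ?addr0 ?subrr // => i.
by move=> /negbTE ->; rewrite scale0r.
Qed.

(** * Projective sums of two submodules *)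

(** K stands for the sum of X and Y, embedded in V by iota. *)
Section SumOfSubmodules.
Variables (V K : lmodType R) (X Y : submodClosed V) (iota : {linear K -> V}).
Hypotheses (iota_inj : injective iota) (Kproj : projective K).
Hypothesis iota_sum : forall k, exists2 x, x \in X & iota k - x \in Y.
Hypothesis X_iota : forall x, x \in X -> exists k, iota k = x.
Hypothesis Y_iota : forall y, y \in Y -> exists k, iota k = y.

(** The surjection from the formal combinations of elements of K splits; rho is
    this splitting followed by a choice of X-components of the generators.  The
    coefficients of k are annihilated by whatever annihilates k. *)
Lemma projective_sum_component : exists rho : {linear K -> V},
  [/\ forall k, rho k \in X, forall k, iota k - rho k \in Y &
      forall t k, t *: k = 0 -> (forall a, t * a = 0 -> a \in m) ->
        rho k \in span_pred (max_mul (X : {pred V}))].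
Proof.
have /choice [xi xiP] k : exists x, x \in X /\ iota k - x \in Y.
  by have [x xX xY] := iota_sum k; exists x.
have [h hP] := Kproj idfun (@cover_surj R K).
pose rho : {linear K -> V} := fglift xi \o h.
have rhoE k : rho k = \sum_(z <- dom (h k)) coeff z (h k) *: xi z.
  rewrite /rho /= -{1}(freeg_sumE (h k)) raddf_sum.
  by apply: eq_bigr => z _ /=; rewrite liftU.
have iotaE k : iota k = \sum_(z <- dom (h k)) coeff z (h k) *: iota z.
  rewrite -{1}(hP k : _ = k) -{1}(freeg_sumE (h k)) raddf_sum raddf_sum.
  by apply: eq_bigr => z _ /=; rewrite liftU linearZ.
exists rho; split=> [k|k|t k tk tm].
- by rewrite rhoE rpred_sum // => z _; rewrite rpredZ //; case: (xiP z).
- rewrite rhoE iotaE -sumrB rpred_sum // => z _.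
  by rewrite -scalerBr rpredZ //; case: (xiP z).
rewrite rhoE rpred_sum // => z _; apply: span_pred_gen.
exists (coeff z (h k)), (xi z); split=> //; last by case: (xiP z).
by apply: tm; rewrite -coeffZ -linearZ tk raddf0 coeff0.
Qed.

(** With rho as above, w = (w - rho w) + rho w for w in the intersection W of X
    and Y.  As id - rho maps X into W and rho maps Y into W, the first summand
    lies in mW because w is in mX, and the second one because w is in mY.  So
    W = mW. *)
Lemma projective_sum_direct :
  (forall W : {pred V}, submod_closed W -> finite_submod W) ->
  (forall w, w \in X -> w \in Y ->
     w \in span_pred (max_mul (X : {pred V})) /\
     w \in span_pred (max_mul (Y : {pred V}))) ->
  forall w, w \in X -> w \in Y -> w = 0.
Proof.
move=> Vnoeth XYm.
have [rho [rhoX rhoY _]] := projective_sum_component.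
pose W : {pred V} := fun w => (w \in X) && (w \in Y).
have memW w : w \in X -> w \in Y -> w \in W by move=> wX wY; apply/andP.
have Wcl : submod_closed W.
  split=> [|a u v /andP [uX uY] /andP [vX vY]]; apply: memW;
    by rewrite ?rpred0 ?rpredD ?rpredZ.
have partX w : w \in span_pred (max_mul (X : {pred V})) ->
    exists2 k, iota k = w & w - rho k \in span_pred (max_mul W).
  pose U : {pred V} := fun w => `[< exists2 k,
    iota k = w & w - rho k \in span_pred (max_mul W) >].
  move=> wmX; apply/asboolP; rewrite -[`[< _ >]]/(w \in U).
  apply: span_pred_min wmX; last first.
    move=> _ [a [x [am xX ->]]]; have [k kx] := X_iota xX.
    apply/asboolP; exists (a *: k); first by rewrite linearZ kx.
    rewrite linearZ -scalerBr span_pred_gen //; exists a, (x - rho k).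
    split=> //; apply: memW; first by rewrite submodClosed_sub.
    by rewrite -kx.
  split=> [|a u v /asboolP [k ku uW] /asboolP [l lv vW]]; apply/asboolP.
    by exists 0; rewrite raddf0 // subr0 rpred0.
  exists (a *: k + l); first by rewrite linearP ku lv.
  by rewrite linearP opprD addrACA -scalerBr rpredD ?rpredZ.
have partY w : w \in span_pred (max_mul (Y : {pred V})) ->
    exists2 k, iota k = w & rho k \in span_pred (max_mul W).
  pose U : {pred V} := fun w => `[< exists2 k,
    iota k = w & rho k \in span_pred (max_mul W) >].
  move=> wmY; apply/asboolP; rewrite -[`[< _ >]]/(w \in U).
  apply: span_pred_min wmY; last first.
    move=> _ [a [y [am yY ->]]]; have [k ky] := Y_iota yY.
    apply/asboolP; exists (a *: k); first by rewrite linearZ ky.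
    rewrite linearZ span_pred_gen //; exists a, (rho k).
    split=> //; apply: memW => //.
    by rewrite -[rho k](subKr (iota k)) submodClosed_sub // ky.
  split=> [|a u v /asboolP [k ku uW] /asboolP [l lv vW]]; apply/asboolP.
    by exists 0; rewrite raddf0 // rpred0.
  exists (a *: k + l); first by rewrite linearP ku lv.
  by rewrite linearP rpredD ?rpredZ.
move=> z zX zY; apply: (nakayama (W := W)); last exact: memW.
  exact: Vnoeth.
move=> w /andP [wX wY]; have [wmX wmY] := XYm w wX wY.
have [k kw wW] := partX w wmX; have [l lw lW] := partY w wmY.
have kl : k = l by apply: iota_inj; rewrite kw.
by rewrite -(subrK (rho k) w) rpredD // kl.
Qed.

(** When the sum is direct, rho is the identity on X, and its coefficients on X
    annihilate t, so they are not invertible and X = mX. *)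
Lemma projective_sum_annihilated (t : R) :
  (forall W : {pred V}, submod_closed W -> finite_submod W) ->
  (forall w, w \in X -> w \in Y -> w = 0) ->
  t != 0 -> (forall x, x \in X -> t *: x = 0) ->
  forall x, x \in X -> x = 0.
Proof.
move=> Vnoeth XY0 t0 tX.
have [rho [rhoX rhoY rho_m]] := projective_sum_component.
apply: nakayama.
  by apply: Vnoeth; split=> [|a u v uX vX]; rewrite ?rpred0 ?rpredD ?rpredZ.
move=> x xX; have [k kx] := X_iota xX.
have -> : x = rho k.
  apply/eqP; rewrite -subr_eq0; apply/eqP/XY0.
    by rewrite submodClosed_sub.
  by rewrite -kx.
apply: (rho_m t) => [|a ta]; last first.
  apply: contraNT t0 => /m_unit [b ba].
  by rewrite -[t]mulr1 -ba mulrCA ta mulr0.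
by apply: iota_inj; rewrite linearZ /= kx tX // raddf0.
Qed.

End SumOfSubmodules.

End LocalRing.

(** * Kernels of presentations *)

Section Presentations.
Local Open Scope ring_scope.
Variable R : comNzRingType.

Definition linear_of (V W : lmodType R) (f : V -> W) (f_lin : linear f) :
  {linear V -> W} :=
  HB.pack f (GRing.isLinear.Build R V W *:%R f f_lin).

Section Corestriction.
Variables (V U : lmodType R) (f : {linear V -> U}) (S : submodClosed U).
Hypothesis fS : forall x, f x \in S.

Lemma corestr_linear : linear (fun x => Submod (fS x) : sub_lmod S).
Proof. by move=> a x y; apply: val_inj; rewrite /= linearP. Qed.

Definition corestr : {linear V -> sub_lmod S} := linear_of corestr_linear.

End Corestriction.

(** A form of Schanuel's lemma.  Comparing the cover F with the resolution
    P1 -> P0 through lifts alpha : F -> P0 and beta : P0 -> F of the identity of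
    T, an element k of the kernel of p is (k - beta (alpha k)) + beta (d c),
    where c depends linearly on k since d is injective.  So the kernel is a
    direct summand of the sum of F and P1. *)
Lemma kernel_projective (F T : lmodType R) (p : {linear F -> T}) :
  projective F -> (forall t, exists x, p x = t) -> projdim_le T 1 ->
  projective (sub_lmod (kernel p)).
Proof.
move=> Fproj p_surj [P P0].
have d_inj x : cx_d P 0 x = 0 -> x = 0.
  by case/res_exact => y <-; rewrite (P0 2 _ y) // raddf0.
have [alpha alphaP] := Fproj _ _ _ p (@res_surj _ _ P).
have [beta betaP] := @res_proj _ _ P 0 _ _ _ (res_aug P) p_surj.
have /choice [gamma gammaP] (k : sub_lmod (kernel p)) :
    exists c, cx_d P 0 c = alpha (submod_val k).
  apply: res_exact0.
  by rewrite alphaP; apply/eqP; exact: (submod_valP k).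
have gamma_lin : linear gamma.
  move=> a k l; apply/eqP; rewrite -subr_eq0; apply/eqP/d_inj.
  by rewrite linearB linearP !gammaP /= linearP subrr.
have e_lin : linear (fun x => x - beta (alpha x)).
  by move=> a x y; rewrite linearP linearP opprD addrACA scalerBr.
have eK x : linear_of e_lin x \in kernel p.
  apply/eqP; change (p (x - beta (alpha x)) = 0).
  by rewrite linearB /= betaP alphaP subrr.
have dK y : (beta \o cx_d P 0 : {linear _ -> _}) y \in kernel p.
  by apply/eqP; change (p (beta (cx_d P 0 y)) = 0); rewrite betaP res_augd.
move=> A B g f g_surj.
have [h1 h1P] := Fproj _ _ _ (f \o corestr eK : {linear _ -> _}) g_surj.
have [h2 h2P] :=
  @res_proj _ _ P 1 _ _ _ (f \o corestr dK : {linear _ -> _}) g_surj.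
have h_lin : linear (fun k => h1 (submod_val k) + h2 (gamma k)).
  move=> a k l; rewrite gamma_lin [submod_val _]/(_ *: _ + _) !linearP.
  by rewrite addrACA scalerDr.
exists (linear_of h_lin) => k.
rewrite /= linearD h1P h2P /= -linearD; congr (f _); apply: val_inj => /=.
by rewrite gammaP subrK.
Qed.

Lemma projdim_leP (T : lmodType R) n : projdim T = Some n -> projdim_le T n.
Proof.
rewrite /projdim; case: pselect => // h [<-].
by case: ex_minnP => k /asboolP.
Qed.

Lemma matrix_projective a b : projective 'M[R]_(a, b).
Proof.
move=> A B g f g_surj.
have [v vP] := choice (fun ij : 'I_a * 'I_b => g_surj (f (delta_mx ij.1 ij.2))).
have h_lin : linear (fun x : 'M[R]_(a, b) => \sum_i \sum_j x i j *: v (i, j)).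
  move=> c x y; rewrite scaler_sumr -big_split; apply: eq_bigr => i _.
  rewrite scaler_sumr -big_split; apply: eq_bigr => j _.
  by rewrite !mxE scalerDl scalerA.
exists (linear_of h_lin) => x; rewrite [in RHS](matrix_sum_delta x) /=.
rewrite !linear_sum; apply: eq_bigr => i _; rewrite !linear_sum.
by apply: eq_bigr => j _; rewrite !linearZ /= vP.
Qed.

End Presentations.

(** * Tensor products in coordinates *)

Section Tensors.
Local Open Scope ring_scope.
Variable R : comNzRingType.

Section Combinations.
Variables (V : lmodType R) (n : nat) (g : 'I_n -> V).

Lemma col_comb_linear : linear (fun c : 'cV[R]_n => \sum_i c i 0 *: g i).
Proof.
move=> k c d; rewrite scaler_sumr -big_split; apply: eq_bigr => i _ /=.
by rewrite !mxE scalerDl scalerA.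
Qed.
Definition col_comb : {linear 'cV[R]_n -> V} := linear_of col_comb_linear.

Lemma row_comb_linear : linear (fun c : 'rV[R]_n => \sum_i c 0 i *: g i).
Proof.
move=> k c d; rewrite scaler_sumr -big_split; apply: eq_bigr => i _ /=.
by rewrite !mxE scalerDl scalerA.
Qed.
Definition row_comb : {linear 'rV[R]_n -> V} := linear_of row_comb_linear.

Lemma col_comb_delta i : col_comb (delta_mx i 0) = g i.
Proof.
rewrite /= (bigD1 i) //= mxE !eqxx scale1r big1 ?addr0 // => j /negbTE ji.
by rewrite mxE ji scale0r.
Qed.

Lemma row_comb_delta i : row_comb (delta_mx 0 i) = g i.
Proof.
rewrite /= (bigD1 i) //= mxE !eqxx scale1r big1 ?addr0 // => j /negbTE ji.
by rewrite mxE ji andbF scale0r.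
Qed.

Lemma free_of_injective_comb :
  (forall x, exists c, col_comb c = x) ->
  (forall c, col_comb c = 0 -> c = 0) -> free_module V.
Proof.
move=> g_surj g_inj; exists 'I_n, g.
pose formal (c : 'cV[R]_n) : free_mod R 'I_n := \sum_i << c i 0 *g i >>.
have lift_formal c : fglift g (formal c) = col_comb c.
  by rewrite raddf_sum; apply: eq_bigr => i _; rewrite /= liftU.
have formalK (f : free_mod R 'I_n) : formal (\col_i coeff i f) = f.
  apply/eqP/freeg_eqP => j; rewrite (raddf_sum (coeff j)) (bigD1 j) //=.
  rewrite coeffU eqxx mxE mulr1 big1 ?addr0 // => i /negbTE ij.
  by rewrite coeffU ij mulr0.
have /choice [coord coordP] := g_surj.
exists (formal \o coord) => [f|x] /=; last by rewrite lift_formal coordP.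
rewrite -[RHS]formalK; congr formal; apply/eqP; rewrite -subr_eq0.
apply/eqP/g_inj; rewrite linearB coordP -lift_formal formalK.
exact: subrr.
Qed.
End Combinations.

Section OuterProducts.
Variables a b : nat.

(** Up to the identification of matrices with the tensor product of the two
    free modules, this is the image of the tensor product of the submodules S
    and T. *)
Definition outer (S : {pred 'cV[R]_a}) (T : {pred 'rV[R]_b}) :
    submodClosed 'M[R]_(a, b) :=
  GRing.SubmodClosed.clone R 'M[R]_(a, b)
    (span_pred (fun A => exists c d, [/\ c \in S, d \in T & A = c *m d])) _.

Lemma outer_mul (S : {pred 'cV[R]_a}) (T : {pred 'rV[R]_b}) c d :
  c \in S -> d \in T -> c *m d \in outer S T.
Proof. by move=> cS dT; apply: span_pred_gen; exists c, d. Qed.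

Lemma outer_mulmx (S : {pred 'cV[R]_a}) (T : {pred 'rV[R]_b}) n
    (A : 'M_(a, n)) (B : 'M_(n, b)) :
  (forall j, col j A \in S) -> (forall j, row j B \in T) ->
  A *m B \in outer S T.
Proof.
move=> AS BT; have -> : A *m B = \sum_j col j A *m row j B.
  apply/matrixP => i k; rewrite summxE !mxE; apply: eq_bigr => j _.
  by rewrite !mxE big_ord1 !mxE.
by rewrite rpred_sum // => j _; apply: outer_mul.
Qed.

Lemma outer_min (S : {pred 'cV[R]_a}) (T : {pred 'rV[R]_b})
    (U : {pred 'M[R]_(a, b)}) :
  submod_closed U ->
  (forall c d, c \in S -> d \in T -> c *m d \in U) ->
  {subset outer S T <= U}.
Proof.
by move=> Ucl SU; apply: span_pred_min => // _ [c [d [cS dT ->]]]; apply: SU.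
Qed.

Lemma outer_col (S : submodClosed 'cV[R]_a) (T : {pred 'rV[R]_b}) A j :
  A \in outer S T -> col j A \in S.
Proof.
move=> AS; pose U : {pred 'M[R]_(a, b)} := fun B => col j B \in S.
rewrite -[_ \in _]/(A \in U); apply: outer_min AS.
  by split=> [|k u v uU vU]; rewrite /in_mem /= /U ?linear0 ?rpred0
    // linearP rpredD ?rpredZ.
move=> c d cS _; rewrite /in_mem /= /U.
have -> : col j (c *m d) = d 0 j *: c.
  by apply/matrixP => k l; rewrite !mxE big_ord1 !ord1 mulrC.
exact: rpredZ.
Qed.

Lemma outer_row (S : {pred 'cV[R]_a}) (T : submodClosed 'rV[R]_b) A i :
  A \in outer S T -> row i A \in T.
Proof.
move=> AT; pose U : {pred 'M[R]_(a, b)} := fun B => row i B \in T.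
rewrite -[_ \in _]/(A \in U); apply: outer_min AT.
  by split=> [|k u v uU vU]; rewrite /in_mem /= /U ?linear0 ?rpred0
    // linearP rpredD ?rpredZ.
move=> c d _ dT; rewrite /in_mem /= /U.
have -> : row i (c *m d) = c i 0 *: d.
  by apply/matrixP => k l; rewrite !mxE big_ord1 !ord1.
exact: rpredZ.
Qed.

Lemma mulmx_colE (c : 'cV[R]_a) (d : 'rV[R]_b) :
  c *m d = \sum_j d 0 j *: (c *m delta_mx 0 j).
Proof.
rewrite {1}(row_sum_delta d) mulmx_sumr; apply: eq_bigr => j _.
by rewrite scalemxAr.
Qed.

Lemma mulmx_rowE (c : 'cV[R]_a) (d : 'rV[R]_b) :
  c *m d = \sum_i c i 0 *: (delta_mx i 0 *m d).
Proof.
have {1}-> : c = \sum_i c i 0 *: delta_mx i 0.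
  rewrite {1}(matrix_sum_delta c); apply: eq_bigr => i _.
  by rewrite big_ord1.
by rewrite mulmx_suml; apply: eq_bigr => i _; rewrite scalemxAl.
Qed.

End OuterProducts.

(** The projection onto the quotient by S and the zero map agree on pure
    tensors. *)
Lemma tensor_span (M N : lmodType R) (S : submodClosed (tensor M N)) :
  (forall x y, tens x y \in S) -> forall t, t \in S.
Proof.
move=> tensS t.
pose q : {linear tensor M N -> quotmod (fun t => t \in S)} :=
  qpi (fun t => t \in S).
pose z : {linear tensor M N -> quotmod (fun t => t \in S)} := \0.
have /qpi_eq : q t = qpi (fun t => t \in S) 0.
  rewrite (tens_ext (f := q) (g := z)) ?raddf0 // => x y.
  change (q (tens x y) = 0); rewrite -[RHS](raddf0 q).
  by apply/qpi_eq; rewrite subr0 span_pred_gen.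
rewrite subr0; apply: span_pred_min => //.
by split=> [|k u v uS vS]; rewrite ?rpred0 ?rpredD ?rpredZ.
Qed.

Section Presented.
Variables (M N : lmodType R) (a b : nat) (g : 'I_a -> M) (h : 'I_b -> N).
Hypothesis g_surj : forall x, exists c, col_comb g c = x.
Hypothesis h_surj : forall y, exists d, row_comb h d = y.

Local Notation relg := (kernel (col_comb g)).
Local Notation relh := (kernel (row_comb h)).

Lemma tensor_comb_linear :
  linear (fun A : 'M[R]_(a, b) => \sum_i \sum_j A i j *: tens (g i) (h j)).
Proof.
move=> c x y; rewrite scaler_sumr -big_split; apply: eq_bigr => i _ /=.
rewrite scaler_sumr -big_split; apply: eq_bigr => j _ /=.
by rewrite !mxE scalerDl scalerA.
Qed.
Definition tensor_comb : {linear 'M[R]_(a, b) -> tensor M N} :=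
  linear_of tensor_comb_linear.

Lemma tens_suml (P : lmodType R) n (c : 'I_n -> R) (x : 'I_n -> P) (y : N) :
  tens (\sum_i c i *: x i) y = \sum_i c i *: tens (x i) y.
Proof.
have tens_lin : linear (fun x : P => tens x y).
  by move=> k u v; rewrite tensDl tensZl.
rewrite -[LHS]/(linear_of tens_lin _) linear_sum.
by apply: eq_bigr => i _; rewrite linearZ.
Qed.

Lemma tens_sumr (P : lmodType R) n (c : 'I_n -> R) (x : P) (y : 'I_n -> N) :
  tens x (\sum_i c i *: y i) = \sum_i c i *: tens x (y i).
Proof.
have tens_lin : linear (fun y : N => tens x y).
  by move=> k u v; rewrite tensDr tensZr.
rewrite -[LHS]/(linear_of tens_lin _) linear_sum.
by apply: eq_bigr => i _; rewrite linearZ.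
Qed.

Lemma tensor_comb_mul c d :
  tensor_comb (c *m d) = tens (col_comb g c) (row_comb h d).
Proof.
rewrite /= tens_suml; apply: eq_bigr => i _; rewrite tens_sumr scaler_sumr.
by apply: eq_bigr => j _; rewrite mxE big_ord1 scalerA.
Qed.

Lemma tensor_comb_surj t : exists A, tensor_comb A = t.
Proof.
pose im : {pred tensor M N} := fun t => `[< exists A, tensor_comb A = t >].
have im_cl : submod_closed im.
  split=> [|k u v /asboolP [A Au] /asboolP [B Bv]]; apply/asboolP.
    by exists 0; rewrite raddf0.
  by exists (k *: A + B); rewrite linearP Au Bv.
apply/asboolP; rewrite -[`[< _ >]]/(t \in im).
have /(_ t) : forall t, t \in span_pred (fun t => t \in im).
  apply: tensor_span => x y; apply: span_pred_gen.
  have [c <-] := g_surj x; have [d <-] := h_surj y.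
  by apply/asboolP; exists (c *m d); rewrite tensor_comb_mul.
exact: span_pred_min.
Qed.


Lemma tensor_comb_outer x y :
  x \in outer relg predT -> y \in outer predT relh ->
  tensor_comb (x + y) = 0.
Proof.
move=> xX yY; rewrite linearD.
have -> : tensor_comb x = 0.
  apply/eqP; rewrite -[_ == _]/(x \in kernel tensor_comb).
  apply: outer_min xX; first exact: ker_pred_closed.
  move=> c d /eqP c0 _; apply/eqP; change (tensor_comb (c *m d) = 0).
  rewrite tensor_comb_mul c0.
  by have := tensZl 0 (0 : M) (row_comb h d); rewrite !scale0r.
have -> : tensor_comb y = 0.
  apply/eqP; rewrite -[_ == _]/(y \in kernel tensor_comb).
  apply: outer_min yY; first exact: ker_pred_closed.
  move=> c d _ /eqP d0; apply/eqP; change (tensor_comb (c *m d) = 0).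
  rewrite tensor_comb_mul d0.
  by have := tensZr 0 (col_comb g c) (0 : N); rewrite !scale0r.
exact: addr0.
Qed.

Section Coordinates.
Variables (cg : M -> 'cV[R]_a) (ch : N -> 'rV[R]_b).
Hypothesis cgK : forall x, col_comb g (cg x) = x.
Hypothesis chK : forall y, row_comb h (ch y) = y.

(** The chosen coordinates of g j need not be those of a basis vector, so G and
    H may differ from the identity, but only by relations. *)
Let G : 'M[R]_a := \matrix_(i, j) cg (g j) i 0.
Let H : 'M[R]_b := \matrix_(i, j) ch (h i) 0 j.

Lemma coord_mulmxE (A : 'M[R]_(a, b)) :
  \sum_i \sum_j A i j *: (cg (g i) *m ch (h j)) = G *m A *m H.
Proof.
apply/matrixP => k l; rewrite [RHS]mxE summxE.
under eq_bigr do rewrite summxE.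
rewrite exchange_big; apply: eq_bigr => j _; rewrite [in RHS]mxE mulr_suml.
apply: eq_bigr => i _; rewrite !mxE big_ord1 mulrA; congr (_ * _).
exact: mulrC.
Qed.

Lemma coord_col_rel j : col j (G - 1%:M) \in relg.
Proof.
apply/eqP; have -> : col j (G - 1%:M) = cg (g j) - delta_mx j 0.
  by apply/matrixP => i k; rewrite !mxE !ord1 eqxx andbT.
by rewrite linearB cgK col_comb_delta subrr.
Qed.

Lemma coord_row_rel i : row i (H - 1%:M) \in relh.
Proof.
apply/eqP; have -> : row i (H - 1%:M) = ch (h i) - delta_mx 0 i.
  by apply/matrixP => k j; rewrite !mxE !ord1 eqxx eq_sym.
by rewrite linearB chK row_comb_delta subrr.
Qed.

(** So A and G A H agree modulo X + Y, and modulo the products of relations when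
    A is in both X and Y. *)
Lemma mulmx_recenter (A : 'M[R]_(a, b)) :
  A = G *m A *m H - ((G - 1%:M) *m A + G *m A *m (H - 1%:M)).
Proof.
rewrite mulmxBl mulmxBr mul1mx mulmx1 [X in _ - X]addrC addrA subrK.
exact: (esym (subKr _ _)).
Qed.

Section Bilinear.
Variable D : 'M[R]_(a, b) -> Prop.

Lemma coord_bilinear_r c :
  (forall e, e \in relh -> c *m e \in span_pred D) ->
  linear (fun y => qpi D (c *m ch y)).
Proof.
move=> relD k y z; rewrite -linearP; apply/qpi_eq.
rewrite scalemxAr -mulmxDr -mulmxBr; apply/relD/eqP.
by rewrite linearB linearP !chK subrr.
Qed.

Lemma coord_bilinear_l d :
  (forall e, e \in relg -> e *m d \in span_pred D) ->
  linear (fun x => qpi D (cg x *m d)).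
Proof.
move=> relD k x z; rewrite -linearP; apply/qpi_eq.
rewrite scalemxAl -mulmxDl -mulmxBl; apply/relD/eqP.
by rewrite linearB linearP !cgK subrr.
Qed.

End Bilinear.

(** Right exactness of the tensor product: coordinates define a map from the
    tensor product of M and N to the quotient of the space of matrices by the
    relations, and it sends the combination with coefficients A to the class
    of A. *)
Lemma tensor_comb_kernel A : tensor_comb A = 0 ->
  exists2 x, x \in outer relg predT & A - x \in outer predT relh.
Proof.
move=> A0.
pose D (B : 'M[R]_(a, b)) := B \in outer relg predT \/ B \in outer predT relh.
have Dl c d : c \in relg -> c *m d \in span_pred D.
  by move=> cg0; apply: span_pred_gen; left; apply: outer_mul.
have Dr c d : d \in relh -> c *m d \in span_pred D.
  by move=> dh0; apply: span_pred_gen; right; apply: outer_mul.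
pose f := tens_lift (b := fun x y => qpi D (cg x *m ch y))
  (fun y => coord_bilinear_l (fun e => Dl e (ch y)))
  (fun x => coord_bilinear_r (fun e => Dr (cg x) e)).
have fE x y : f (tens x y) = qpi D (cg x *m ch y) by apply: tens_liftE.
have : f (tensor_comb A) = 0 by rewrite A0 raddf0.
have -> : f (tensor_comb A) = qpi D (G *m A *m H).
  rewrite -coord_mulmxE linear_sum [RHS]linear_sum; apply: eq_bigr => i _.
  rewrite linear_sum [RHS]linear_sum; apply: eq_bigr => j _.
  by rewrite linearZZ [RHS]linearZZ fE.
rewrite -[RHS](raddf0 (qpi D)) => /qpi_eq; rewrite subr0 => GAH.
have : A \in span_pred D.
  rewrite (mulmx_recenter A).
  rewrite submodClosed_sub // rpredD //; apply: span_pred_gen.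
    by left; apply: outer_mulmx => // j; apply: coord_col_rel.
  by right; apply: outer_mulmx => // j; apply: coord_row_rel.
pose U : {pred 'M[R]_(a, b)} := fun B => `[< exists2 x,
  x \in outer relg predT & B - x \in outer predT relh >].
move=> AD; apply/asboolP; rewrite -[`[< _ >]]/(A \in U).
apply: span_pred_min AD; last first.
  move=> B [BX|BY]; apply/asboolP; first by exists B; rewrite // subrr rpred0.
  by exists 0; rewrite ?rpred0 ?subr0.
split=> [|k u v /asboolP [x xX uY] /asboolP [y yX vY]]; apply/asboolP.
  by exists 0; rewrite ?subr0 rpred0.
exists (k *: x + y); first by rewrite rpredD ?rpredZ.
by rewrite opprD addrACA -scalerBr rpredD ?rpredZ.
Qed.

(** A matrix A whose columns are relations between the g i and whose rows are
    relations between the h j gives the 1-cycle u, the sum over j of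
    (column j of A) tensor h j.  If u is a boundary, then A is in the image of
    the tensor product of the two relation modules: coordinates define a map
    from the 1-chains to the matrices modulo that image, which kills the
    boundaries and sends u to the class of A. *)
Lemma Tor1_zero_outer A : (forall x : Tor M N 1, x = 0) ->
  A \in outer relg predT -> A \in outer predT relh -> A \in outer relg relh.
Proof.
move=> tor0 AX AY.
have colA j : col j A \in relg by apply: outer_col AX.
have rowA i : row i A \in relh by apply: outer_row AY.
pose D (B : 'M[R]_(a, b)) := B \in outer relg relh.
have D_outer B : B \in span_pred D -> B \in outer relg relh.
  apply: span_pred_min => //.
  by split=> [|k u v uS vS]; rewrite ?rpred0 ?rpredD ?rpredZ.
(* Tor is computed with the free module on the set M, which alpha and beta
   compare with the free module on the generators. *)
pose alpha : {linear 'cV[R]_a -> free_mod R M} :=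
  col_comb (fun i => << g i >> : free_mod R M).
pose beta : {linear free_mod R M -> 'cV[R]_a} := fglift cg.
have alphaP c : Defs.cover M (alpha c) = col_comb g c.
  rewrite linear_sum; apply: eq_bigr => i _.
  by rewrite linearZ /= liftU scale1r.
have betaU c x : beta << c *g x >> = c *: cg x by rewrite /beta /= liftU.
have betaP f : col_comb g (beta f) = Defs.cover M f.
  rewrite -(freeg_sumE f) !linear_sum; apply: eq_bigr => x _.
  by rewrite betaU linearZZ cgK /= liftU.
have beta_d (x : std_obj M 1) : beta (std_d x) \in relg.
  by apply/eqP; rewrite betaP; apply: (std_cover_d (n := 0)).
have Dbil (x : std_obj M 1) e :
    e \in relh -> beta (std_d x) *m e \in span_pred D.
  by move=> eh; apply: span_pred_gen; apply: outer_mul.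
have b_lin y : linear (fun x : std_obj M 1 => qpi D (beta (std_d x) *m ch y)).
  move=> k x z; rewrite -linearP; congr (qpi D _).
  by rewrite scalemxAl -mulmxDl std_d_linear linearP.
pose f := tens_lift b_lin (fun x => coord_bilinear_r (Dbil x)).
have fE x y : f (tens x y) = qpi D (beta (std_d x) *m ch y).
  exact: tens_liftE.
have alpha_ker j : alpha (col j A) \in kernel (Defs.cover M).
  by apply/eqP; rewrite alphaP; apply/eqP/colA.
pose k j : syzygy M 1 := Submod (alpha_ker j).
pose u : tensor_complex N (std_resolution M) 1%N :=
  \sum_j tens (<< k j >> : std_obj M 1) (h j).
have dk j : std_d (<< k j >> : std_obj M 1) = alpha (col j A).
  by rewrite /std_d /= liftU scale1r.
have d_tens n (x : std_obj M n.+1) y :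
    cx_d (tensor_complex N (std_resolution M)) n (tens x y) = tens (std_d x) y.
  exact: tens_mapE.
have du : cx_d (tensor_complex N (std_resolution M)) 0 u = 0.
  rewrite linear_sum.
  under eq_bigr => j _ do rewrite d_tens dk tens_suml.
  rewrite exchange_big big1 // => i _.
  under eq_bigr do rewrite mxE.
  rewrite -tens_sumr.
  have /eqP := rowA i; rewrite /=; under eq_bigr do rewrite mxE.
  move=> ->; have := tensZr 0 (<< g i >> : std_obj M 0) (0 : N).
  by rewrite !scale0r.
have uZ : u \in cycles (tensor_complex N (std_resolution M)) 1.
  exact/eqP.
have /qpi_eq : qpi (@boundary _ _ 1) (Submod uZ) = qpi (@boundary _ _ 1) 0.
  by rewrite raddf0; apply: tor0.
rewrite subr0 => uB.
have val_lin : linear (fun z : sub_lmod (cycles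
  (tensor_complex N (std_resolution M)) 1) => f (submod_val z)).
  by move=> c x y; rewrite -linearP.
have fd0 z : f (cx_d (tensor_complex N (std_resolution M)) 1 z) = 0.
  pose F : {linear tensor (std_obj M 2) N -> quotmod D} :=
    f \o cx_d (tensor_complex N (std_resolution M)) 1.
  pose F0 : {linear tensor (std_obj M 2) N -> quotmod D} := \0.
  apply: (tens_ext (f := F) (g := F0)) => x y.
  change (f (cx_d (tensor_complex N (std_resolution M)) 1 (tens x y)) = 0).
  by rewrite d_tens fE std_dd raddf0 mul0mx raddf0.
have : f u = 0.
  have := span_ker (f := linear_of val_lin) _ uB; apply.
  by move=> z [y /= <-]; apply: fd0.
have -> : f u = qpi D (G *m A *m H).
  rewrite linear_sum -coord_mulmxE exchange_big linear_sum.
  apply: eq_bigr => j _.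
  rewrite fE dk; congr (qpi D _).
  rewrite [beta _]linear_sum mulmx_suml; apply: eq_bigr => i _.
  by rewrite linearZZ mxE -scalemxAl betaU scale1r.
rewrite -[RHS](raddf0 (qpi D)) => /qpi_eq; rewrite subr0 => /D_outer GAH.
rewrite (mulmx_recenter A).
rewrite submodClosed_sub // rpredD //.
  by apply: outer_mulmx => // j; apply: coord_col_rel.
apply: outer_mulmx => j; last exact: coord_row_rel.
have -> : col j (G *m A) = beta (alpha (col j A)).
  rewrite [RHS]linear_sum; apply/matrixP => i l; rewrite ord1 !mxE summxE.
  by apply: eq_bigr => i' _; rewrite linearZZ betaU scale1r !mxE mulrC.
by apply/eqP; rewrite betaP alphaP; apply/eqP/colA.
Qed.
End Coordinates.
End Presented.
End Tensors.

(** * Minimal presentations and the vanishing of Tor *)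

Section Vanishing.
Local Open Scope ring_scope.
Variable R : comNzRingType.

Lemma matrix_spanned (a b : nat) (W : {pred 'M[R]_(a, b)}) :
  spans W (fun k : 'I_#|{: 'I_a * 'I_b}| =>
    delta_mx (enum_val k).1 (enum_val k).2).
Proof.
move=> x _; exists (fun k => x (enum_val k).1 (enum_val k).2).
rewrite {1}(matrix_sum_delta x) pair_big /=.
by rewrite (reindex _ (onW_bij _ (enum_val_bij _))).
Qed.

(** The two nonfree modules enter asymmetrically: one nonzero relation d between
    the generators h is enough to exclude every nonzero relation between the
    generators g. *)
Lemma tensor_pd1_Tor (m : {pred R}) (M N : lmodType R) (a b : nat)
    (g : 'I_a -> M) (h : 'I_b -> N) :
  noetherian_ring R -> ideal m -> 1 \notin m ->
  (forall x, x \notin m -> exists y, y * x = 1) ->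
  (forall x, exists c, col_comb g c = x) ->
  (forall y, exists d, row_comb h d = y) ->
  (forall c, col_comb g c = 0 -> forall i, c i 0 \in m) ->
  (forall d, row_comb h d = 0 -> forall j, d 0 j \in m) ->
  projdim_le (tensor M N) 1 -> (forall x : Tor M N 1, x = 0) ->
  forall c d, col_comb g c = 0 -> row_comb h d = 0 -> d != 0 -> c = 0.
Proof.
move=> noeth mcl m1 m_unit g_surj h_surj gm hm pd1 tor0 c d cg0 dh0 d0.
have [cg cgK] := choice g_surj; have [ch chK] := choice h_surj.
pose relg := kernel (col_comb g); pose relh := kernel (row_comb h).
pose X : submodClosed _ := outer relg (predT : {pred 'rV[R]_b}).
pose Y : submodClosed _ := outer (predT : {pred 'cV[R]_a}) relh.
pose K := sub_lmod (kernel (tensor_comb g h)).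
have iota_lin : linear (fun k : K => submod_val k) by [].
have Kproj : projective K.
  apply: kernel_projective pd1; first exact: matrix_projective.
  exact: tensor_comb_surj.
have inK A : tensor_comb g h A = 0 -> exists k : K, linear_of iota_lin k = A.
  move=> A0.
  by exists (Submod (introT eqP A0 : A \in kernel (tensor_comb g h))).
have Vnoeth (W : {pred 'M[R]_(a, b)}) : submod_closed W -> finite_submod W.
  by move=> Wcl; apply: (noetherian_submod noeth Wcl (matrix_spanned (W := W))).
have iota_inj : injective (linear_of iota_lin) by exact: val_inj.
have iota_sum (k : K) :
    exists2 x, x \in X & linear_of iota_lin k - x \in Y.
  by apply: (tensor_comb_kernel cgK chK); apply/eqP/(submod_valP k).
have X_iota x : x \in X -> exists k : K, linear_of iota_lin k = x.
  move=> xX; apply: inK; rewrite -[x]addr0.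
  by apply: tensor_comb_outer xX _; apply: rpred0.
have Y_iota y : y \in Y -> exists k : K, linear_of iota_lin k = y.
  move=> yY; apply: inK; rewrite -[y]add0r.
  by apply: tensor_comb_outer _ yY; apply: rpred0.
have XYm w : w \in X -> w \in Y ->
    w \in span_pred (max_mul m (X : {pred _})) /\
    w \in span_pred (max_mul m (Y : {pred _})).
  move=> wX wY; have wZ := Tor1_zero_outer cgK chK tor0 wX wY.
  split; apply: outer_min wZ => [|e f /eqP eg /eqP fh];
    try exact: span_pred_closed.
    rewrite mulmx_colE rpred_sum // => j _; apply: span_pred_gen.
    exists (f 0 j), (e *m delta_mx 0 j); split=> //; first exact: hm.
    by apply: outer_mul => //; apply/eqP.
  rewrite mulmx_rowE rpred_sum // => i _; apply: span_pred_gen.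
  exists (e i 0), (delta_mx i 0 *m f); split=> //; first exact: gm.
  by apply: outer_mul => //; apply/eqP.
have XY0 := projective_sum_direct mcl m1 m_unit iota_inj Kproj iota_sum
  X_iota Y_iota Vnoeth XYm.
have /rV0Pn [j dj0] := d0.
have tX x : x \in X -> d 0 j *: x = 0.
  move=> xX; apply/eqP.
  pose U : {pred 'M[R]_(a, b)} := fun x => d 0 j *: x == 0.
  rewrite -[_ == _]/(x \in U); apply: outer_min xX.
    split=> [|k u v /eqP u0 /eqP v0]; apply/eqP; first exact: scaler0.
    by rewrite scalerDr scalerA mulrC -scalerA u0 v0 scaler0 addr0.
  move=> e f eg _; apply/eqP; rewrite scalemxAl.
  have ed0 : e *m d = 0.
    by apply: XY0; apply: outer_mul => //; apply/eqP.
  have -> : d 0 j *: e = 0.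
    apply/matrixP => i k; rewrite !mxE ord1.
    by have /matrixP /(_ i j) := ed0; rewrite !mxE big_ord1 mulrC.
  exact: mul0mx.
have X0 := projective_sum_annihilated mcl m1 m_unit iota_inj Kproj iota_sum
  X_iota Vnoeth XY0 dj0 tX.
have cX : c *m delta_mx 0 j = 0.
  by apply: X0; apply: outer_mul => //; apply/eqP.
apply/matrixP => i k; have /matrixP /(_ i j) := cX.
by rewrite (ord1 k) !mxE big_ord1 !mxE !eqxx mulr1.
Qed.

End Vanishing.

Theorem corollary1p5 (R : comNzRingType) (M N : lmodType R) :
  noetherian_ring R -> local_ring R ->
  fin_gen M -> fin_gen N ->
  ~ free_module M -> ~ free_module N ->
  projdim (tensor M N) = Some 1%N ->
  exists x : Tor M N 1, x <> 0%R.
Proof.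
move=> noeth /local_ring_units [m [mcl m1 m_unit]] Mfin Nfin Mfree Nfree.
move=> /projdim_leP pd1; apply: contrapT => tor.
have tor0 (x : Tor M N 1) : x = 0%R.
  by apply: contrapT => x0; apply: tor; exists x.
have fin (V : lmodType R) : fin_gen V -> finite_submod (predT : {pred V}).
  by case=> n [g gV]; exists n, g; split.
have [a [g [[_ gM] g_min]]] := minimal_generators m_unit (fin _ Mfin).
have [b [h [[_ hN] h_min]]] := minimal_generators m_unit (fin _ Nfin).
have g_surj x : exists c, col_comb g c = x.
  have [c ->] := gM x isT; exists (\col_i c i)%R.
  by apply: eq_bigr => i _; rewrite mxE.
have h_surj y : exists d, row_comb h d = y.
  have [d ->] := hN y isT; exists (\row_j d j)%R.
  by apply: eq_bigr => j _; rewrite mxE.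
have rel0 := tensor_pd1_Tor noeth mcl m1 m_unit g_surj h_surj
  (fun c => g_min (fun i => c i 0)%R) (fun d => h_min (fun j => d 0 j)%R)
  pd1 tor0.
apply: Nfree; apply: (free_of_injective_comb (g := h)) => [y|d d0].
  by have [d <-] := h_surj y; exists (d^T)%R;
    apply: eq_bigr => j _; rewrite mxE.
apply: contrapT => d_neq0; apply: Mfree.
apply: (free_of_injective_comb g_surj) => c c0.
apply: (rel0 c (d^T)%R) => //.
  by rewrite -d0; apply: eq_bigr => j _; rewrite mxE.
by apply/eqP => dT0; apply: d_neq0; rewrite -[d]trmxK dT0 trmx0.
Qed.
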